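(* With $W_H,W_L,W_J$, $A$ and $\alpha_1,\beta_1$ as in the context, let $K=\sum_{j=1}^{\lfloor N/2\rfloor}E_{2j,2j}$, $B_H=\sum_{j=1}^N2b_jE_{j,j}$, $B_L=\sum_{j=1}^N(\alpha_j+1)E_{j,j}$, $B_J=\sum_{j=1}^N(\beta_j-\alpha_j)E_{j,j}$. Then $D_H=\partial^2I+\partial\big(2A+B_H-2xI+x[A,B_H]\big)+AB_H+2K\in\mathcal D(W_H)$, $D_L=\partial^2xI+\partial\big(B_L-xI+2xA+x[A,B_L]\big)+AB_L+K\in\mathcal D(W_L)$, $D_J=\partial^2(1-x^2)I+\partial\big(2A+B_J+x([A,B_J]+2K-(\alpha_1+\beta_1+2)I)\big)+AB_J+(\alpha_1+\beta_1)K\in\mathcal D(W_J)$.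
   Context: Classical scalar weights: Hermite $w_b(x)=e^{-x^2+2bx}$ on $\mathbb R$; Laguerre $w_\alpha(x)=e^{-x}x^\alpha$ on $(0,\infty)$, $\alpha>-1$; Jacobi $w_{\alpha,\beta}(x)=(1-x)^\alpha(1+x)^\beta$ on $(-1,1)$, $\alpha,\beta>-1$. Let $N\ge2$, $A=\sum_{j=1}^{\lfloor N/2\rfloor}a_{2j-1}E_{2j-1,2j}+\sum_{j=1}^{\lfloor (N-1)/2\rfloor}a_{2j}E_{2j+1,2j}$ ($E_{s,t}$ matrix units, all $a_j\in\mathbb R\setminus\{0\}$), $T(x)=I+Ax$. $W_H=T\,\mathrm{diag}(w_{b_1},\dots,w_{b_N})\,T^*$ with $b_i$ pairwise distinct reals; $W_L=T\,\mathrm{diag}(w_{\alpha_1},\dots,w_{\alpha_N})\,T^*$ with $\alpha_i-\alpha_j\notin\mathbb Z$ for $i\ne j$; $W_J=T\,\mathrm{diag}(w_{\alpha_1,\beta_1},\dots,w_{\alpha_N,\beta_N})\,T^*$ with, for $i\ne j$, $\alpha_i-\alpha_j\notin\mathbb Z$ or $\beta_i-\beta_j\notin\mathbb Z$, and $\alpha_1+\beta_1=\alpha_j+\beta_j+1+(-1)^j$ for all $j$. $[X,Y]=XY-YX$. Differential operators $\partial^2F_2+\partial F_1+F_0$ act on the right: $P\cdot D=P''F_2+P'F_1+PF_0$. For a weight matrix $W$ with monic orthogonal polynomials $P_n$ (w.r.t. $\langle P,Q\rangle=\int PWQ^*dx$), $\mathcal D(W)$ is the algebra of differential operators with matrix polynomial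 coefficients such that $P_n\cdot D=\Lambda_n(D)P_n$ for all $n\ge0$ with constant matrices $\Lambda_n(D)$. *)

(* Defs.v *)
From HB Require Import structures.
From mathcomp Require Import all_boot all_order all_algebra.
From mathcomp Require Import all_classical all_reals all_analysis.
Set Implicit Arguments.
Unset Strict Implicit.
Unset Printing Implicit Defensive.
Import Order.TTheory GRing.Theory Num.Theory.
Local Open Scope classical_set_scope.
Local Open Scope ring_scope.

Section Defs.
Variables (R : realType) (N : nat).

Definition mpoly := 'M[{poly R}]_N.

Definition cmx (M : 'M[R]_N) : mpoly := map_mx polyC M.

Definition mx_eval (P : mpoly) (x : R) : 'M[R]_N := map_mx (fun p => p.[x]) P.

Definition mx_deriv (P : mpoly) : mpoly := map_mx (fun p => p^`()) P.

Definition deg_lt (P : mpoly) (m : nat) : Prop := forall i j, (size (P i j) <= m)%N.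

Definition mcoef (P : mpoly) (n : nat) : 'M[R]_N := \matrix_(i, j) (P i j)`_n.

Definition monic_deg (P : mpoly) (n : nat) : Prop :=
  deg_lt P n.+1 /\ mcoef P n = 1%:M.

(* entry (i,j) of the inner product <P,Q> = \int_I P(x) W(x) Q(x)^* dx
   (real matrices, so Q^* = Q^T), as an extended real Lebesgue integral *)
Definition ip (I : set R) (W : R -> 'M[R]_N) (P Q : mpoly) (i j : 'I_N) : \bar R :=
  (\int[lebesgue_measure]_(x in I)
     (((mx_eval P x) *m W x *m (mx_eval Q x)^T) i j)%:E)%E.

Definition is_MOPS (I : set R) (W : R -> 'M[R]_N) (P : nat -> mpoly) : Prop :=
  forall n, monic_deg (P n) n /\
    (forall Q : mpoly, deg_lt Q n -> forall i j, ip I W (P n) Q i j = 0%E).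

Record diffop := DiffOp { F2 : mpoly; F1 : mpoly; F0 : mpoly }.

Definition act (P : mpoly) (D : diffop) : mpoly :=
  mx_deriv (mx_deriv P) *m F2 D + mx_deriv P *m F1 D + P *m F0 D.

Definition in_DW (I : set R) (W : R -> 'M[R]_N) (D : diffop) : Prop :=
  forall P : nat -> mpoly, is_MOPS I W P ->
    forall n, exists Lam : 'M[R]_N, act (P n) D = cmx Lam *m P n.

(* The matrix A (1-indexed parameters a_1..a_{N-1}):
   A_{2j-1,2j} = a_{2j-1}, A_{2j+1,2j} = a_{2j}.  With 0-indexed rows/cols. *)
Definition Amx (a : nat -> R) : 'M[R]_N :=
  \matrix_(r, c)
    (if (c == r.+1 :> nat) && ~~ odd r then a r.+1
     else if (r == c.+1 :> nat) && odd c then a c.+1 else 0).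

(* K = sum_j E_{2j,2j} (1-indexed even diagonal positions) *)
Definition Kmx : 'M[R]_N := \matrix_(r, c) (((r == c) && odd r)%:R).

(* diagonal matrix diag(d_1, ..., d_N) with 1-indexed d *)
Definition diagN (d : nat -> R) : 'M[R]_N := \matrix_(r, c) ((r == c)%:R * d r.+1).

Definition comm (X Y : 'M[R]_N) : 'M[R]_N := X *m Y - Y *m X.

Definition Tmx (a : nat -> R) (x : R) : 'M[R]_N := 1%:M + x *: Amx a.

Definition Wmx (a : nat -> R) (w : nat -> R -> R) (x : R) : 'M[R]_N :=
  Tmx a x *m diagN (fun j => w j x) *m (Tmx a x)^T.

Definition w_herm (b x : R) : R := expR (- x ^+ 2 + 2 * b * x).
Definition w_lag (al x : R) : R := expR (- x) * powR x al.
Definition w_jac (al be x : R) : R := powR (1 - x) al * powR (1 + x) be.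

Definition W_H a (b : nat -> R) := Wmx a (fun j => w_herm (b j)).
Definition W_L a (al : nat -> R) := Wmx a (fun j => w_lag (al j)).
Definition W_J a (al be : nat -> R) := Wmx a (fun j => w_jac (al j) (be j)).

Definition B_H (b : nat -> R) := diagN (fun j => 2 * b j).
Definition B_L (al : nat -> R) := diagN (fun j => al j + 1).
Definition B_J (al be : nat -> R) := diagN (fun j => be j - al j).

Definition D_H a b : diffop :=
  let A := Amx a in let B := B_H b in
  DiffOp (cmx 1%:M)
         (cmx (2 *: A + B) + 'X *: cmx (comm A B - 2%:M))
         (cmx (A *m B + 2 *: Kmx)).

Definition D_L a al : diffop :=
  let A := Amx a in let B := B_L al in
  DiffOp ('X *: cmx 1%:M)
         (cmx B + 'X *: cmx (- 1%:M + 2 *: A + comm A B))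
         (cmx (A *m B + Kmx)).

Definition D_J a al be : diffop :=
  let A := Amx a in let B := B_J al be in
  DiffOp ((1 - 'X ^+ 2) *: cmx 1%:M)
         (cmx (2 *: A + B) +
          'X *: cmx (comm A B + 2 *: Kmx - (al 1%N + be 1%N + 2)%:M))
         (cmx (A *m B + (al 1%N + be 1%N) *: Kmx)).

End Defs.

(* Main.v *)
Require Import Defs.
From HB Require Import structures.
From mathcomp Require Import all_boot all_order all_algebra.
From mathcomp Require Import all_classical all_reals all_analysis.
From mathcomp Require Import measurable_realfun ring lra zify.
Import Order.TTheory GRing.Theory Num.Theory numFieldNormedType.Exports.
Local Open Scope classical_set_scope.
Local Open Scope ring_scope.

(* Let [T = I + A x].  Each operator [D] of the theorem satisfies
   [(P . D) T = (P T) . delta], where [delta] is diagonal and its diagonal entries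
   are the classical second order operators [sigma d^2 + tau d + c] of the scalar
   weights.  Since [<P, Q>_W] is the sum over [k] of the scalar products of the
   [k]-th columns of [P T] and [Q T], and since each scalar operator is symmetric
   by the Pearson equation [(sigma w)' = tau w], [D] is symmetric for [W].  As [D]
   does not raise degrees, [P_n . D] is orthogonal to all polynomials of degree
   less than [n], so that subtracting its leading term times [P_n] leaves a
   polynomial of degree less than [n] that is orthogonal to itself, hence zero. *)

Set Implicit Arguments.
Unset Strict Implicit.
Unset Printing Implicit Defensive.

(** * Integrals of derivatives over an exhausted interval *)

Section exhaustion.
Variable R : realType.
Implicit Types (I : set R) (f g F G w : R -> R) (u v : nat -> R).
Notation mu := (@lebesgue_measure R).

(** Compact intervals increasing to [I]: the fundamental theorem of calculus applies on each of
    them, and a limit then reaches [I]. This treats the three supports uniformly. *)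
Definition exhausts u v I :=
  [/\ nonincreasing_seq u, nondecreasing_seq v, forall n, u n < v n
    & I = \bigcup_n `[u n, v n]%classic].

Lemma exhausts_sub u v I n : exhausts u v I -> `[u n, v n] `<=` I.
Proof. by move=> [_ _ _ ->] x xn; exists n. Qed.

Lemma exhausts_measurable u v I : exhausts u v I -> measurable I.
Proof. by move=> [_ _ _ ->]; exact: bigcup_measurable. Qed.

Lemma exhausts_mono u v I : exhausts u v I ->
  nondecreasing_seq (fun n => `[u n, v n]%classic).
Proof.
move=> [du dv _ _] m n mn; apply/subsetPset => x /=; rewrite !in_itv/=.
by move=> /andP[ux xv]; rewrite (le_trans (du _ _ mn) ux) (le_trans xv (dv _ _ mn)).
Qed.

Lemma continuous_on_measurable u v I f : exhausts u v I ->
  (forall x, I x -> {for x, continuous f}) -> measurable_fun I f.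
Proof.
move=> e cf; have [_ _ _ IE] := e; rewrite IE.
apply/measurable_fun_bigcup => // n.
apply: subspace_continuous_measurable_fun => //.
apply: continuous_in_subspaceT => x; rewrite inE => /(exhausts_sub e).
exact: cf.
Qed.

Lemma integral_exhausts u v I f F n : exhausts u v I ->
  (forall x, I x -> {for x, continuous f}) ->
  (forall x, I x -> is_derive x 1 F (f x)) ->
  (\int[mu]_(x in `[u n, v n]) (f x)%:E = (F (v n) - F (u n))%:E)%E.
Proof.
move=> e cf dF; have [_ _ /(_ n) uv _] := e.
have uvI : `[u n, v n] `<=` I by exact: exhausts_sub.
have cF x : I x -> {for x, continuous F}.
  by move=> /dF dFx; apply/differentiable_continuous/derivable1_diffP.
rewrite (@continuous_FTC2 _ f F)// ?EFinB//.
- apply: continuous_in_subspaceT => x; rewrite inE => /uvI; exact: cf.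
- split.
  + move=> x xuv; have /dF : I x by apply: uvI; exact: subset_itv_oo_cc.
    by [].
  + apply: cvg_at_right_filter; apply: cF; apply: uvI.
    by rewrite /= in_itv/= lexx ltW.
  + apply: cvg_at_left_filter; apply: cF; apply: uvI.
    by rewrite /= in_itv/= lexx ltW.
- move=> x xuv; have /dF dFx : I x by apply: uvI; exact: subset_itv_oo_cc.
  by rewrite derive1E; exact: derive_val.
Qed.

(** The integral of [g] over the [n]-th interval is [G (v n) - G (u n)], at most [M + M]; since [g]
    is nonnegative, monotone convergence carries this bound to [I]. *)
Lemma integrable_bounded_primitive u v I g G (M : R) : exhausts u v I ->
  (forall x, I x -> {for x, continuous g}) ->
  (forall x, I x -> is_derive x 1 G (g x)) ->
  (forall x, I x -> 0 <= g x) ->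
  (forall x, I x -> `|G x| <= M) ->
  mu.-integrable I (EFin \o g).
Proof.
move=> e cg dG g0 GM; have mI := exhausts_measurable e.
have mg := continuous_on_measurable e cg.
apply/integrableP; split; first exact/measurable_EFinP.
have -> : (\int[mu]_(x in I) `|(EFin \o g) x| = \int[mu]_(x in I) (g x)%:E)%E.
  by apply: eq_integral => x; rewrite inE => /g0 gx; rewrite /= ger0_norm.
have h : (\int[mu]_(x in `[u i, v i]) (g x)%:E @[i --> \oo] -->
          \int[mu]_(x in I) (g x)%:E)%E.
  have [_ _ _ IE] := e; rewrite [in X in _ --> X]IE.
  apply: ge0_nondecreasing_set_cvg_integral => //.
  - exact: exhausts_mono e.
  - move=> i; apply/measurable_EFinP.
    by apply: measurable_funS mg => //; exact: exhausts_sub.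
  - by move=> i x /(exhausts_sub e) /g0; rewrite lee_fin.
apply: (@le_lt_trans _ _ (M + M)%:E); last exact: ltry.
rewrite -(cvg_lim _ h)//; apply: lime_le; first by apply/cvg_ex; eexists; exact: h.
apply: nearW => n; rewrite (integral_exhausts n e cg dG) lee_fin.
have [_ _ /(_ n) uv _] := e.
have := GM (v n); have := GM (u n) => /(_ _)Gu /(_ _)Gv.
rewrite (le_trans (ler_norm _))// (le_trans (ler_normB _ _))// lerD//.
  by apply: Gv; apply: (exhausts_sub (n := n) e); rewrite /= in_itv/= lexx ltW.
by apply: Gu; apply: (exhausts_sub (n := n) e); rewrite /= in_itv/= lexx ltW.
Qed.

Lemma integrable_dominated u v I f g : exhausts u v I ->
  (forall x, I x -> {for x, continuous f}) ->
  mu.-integrable I (EFin \o g) ->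
  (forall x, I x -> `|f x| <= g x) ->
  mu.-integrable I (EFin \o f).
Proof.
move=> e cf ig fg; apply: le_integrable ig => //.
- exact: exhausts_measurable e.
- by apply/measurable_EFinP; exact: continuous_on_measurable e cf.
- by move=> x Ix /=; rewrite lee_fin (le_trans (fg _ Ix))// ler_norm.
Qed.

(** On the [n]-th interval the integral is [F (v n) - F (u n)], which tends to 0; dominated
    convergence identifies the limit with the integral over [I]. *)
Lemma integral_derivative_eq0 u v I f F : exhausts u v I ->
  (forall x, I x -> {for x, continuous f}) ->
  mu.-integrable I (EFin \o f) ->
  (forall x, I x -> is_derive x 1 F (f x)) ->
  F (u n) @[n --> \oo] --> 0 -> F (v n) @[n --> \oo] --> 0 ->
  (\int[mu]_(x in I) (f x)%:E = 0)%E.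
Proof.
move=> e cf fi dF Fu Fv; have mI := exhausts_measurable e.
have mf := continuous_on_measurable e cf.
pose fn n := (EFin \o f) \_ `[u n, v n].
have mfn n : measurable_fun I (fn n).
  apply/measurable_restrict => //.
  apply/measurable_EFinP; apply: measurable_funS mf => //.
(* The truncations [fn] are dominated by the absolute value of [f]. At each point of [I] they are
   eventually constant, because the intervals increase. *)
have [||||_ _] := @dominated_convergence _ _ _ mu I mI fn (EFin \o f)
    (fun x => `|(EFin \o f) x|%E) mfn _.
- exact/measurable_EFinP.
- apply: aeW => x; have [_ _ _ {1}->] := e => -[n _ xn].
  apply: cvg_near_cst; near=> m.
  have nm : (n <= m)%N by near: m; exact: nbhs_infty_ge.
  have /subsetPset uv_sub := exhausts_mono e nm.
  by rewrite /fn patchE mem_set//; exact: uv_sub.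
- exact: integrable_abse.
- apply: aeW => x n Ix; rewrite /fn patchE.
  by case: ifPn => // _; rewrite abse0 abse_ge0.
move=> /cvg_lim h; rewrite -[LHS]h//.
have -> : (fun n => \int[mu]_(x in I) fn n x)%E = EFin \o (fun n => F (v n) - F (u n)).
  apply/funext => n /=; rewrite /fn -(integral_exhausts n e cf dF).
  by rewrite -integral_mkcondr setIidr//; exact: exhausts_sub.
apply/cvg_lim => //; apply/cvg_EFin; first exact: nearW.
by rewrite -[X in _ --> X](subrr (0:R)); exact: cvgB.
Unshelve. all: by end_near. Qed.

Lemma exhausts_measure_neq0 u v I : exhausts u v I -> mu I != 0%E.
Proof.
move=> e; have mI := exhausts_measurable e.
have [_ _ /(_ 0%N) uv _] := e.
rewrite gt_eqF//; apply: (@lt_le_trans _ _ (mu `[u 0%N, v 0%N]%classic)).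
  by rewrite lebesgue_measure_itv/= lte_fin uv -EFinB lte_fin subr_gt0.
by apply: le_measure; rewrite ?inE//; exact: exhausts_sub.
Qed.

End exhaustion.

(** * Scalar weights and the Pearson equation *)

Section pearson.
Variable R : realType.
Notation mu := (@lebesgue_measure R).
Implicit Types (I : set R) (w g G : R -> R) (p r : {poly R}).

(** The last clause is the Pearson equation in integrated form: the integrand stands for the
    derivative of [r * sigma * w], whose boundary values vanish. No derivative of [w] remains, so
    later arguments are algebraic. *)
Definition pearson_weight I w (sigma tau : {poly R}) :=
  [/\ forall x, I x -> 0 < w x,
      forall p, mu.-integrable I (fun x => (p.[x] * w x)%:E) &
      forall r, (\int[mu]_(x in I)
        ((tau * r + sigma * r^`()).[x] * w x)%:E = 0)%E].

Lemma cvg0_dominated (f h : nat -> R) (C : R) :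
  (forall n, `|f n| <= C * h n) -> h n @[n --> \oo] --> 0 ->
  f n @[n --> \oo] --> 0.
Proof.
move=> fh h0; apply: norm_cvg0.
apply: (@squeeze_cvgr _ _ _ _ (cst 0) (fun n => C * h n)).
- by apply: nearW => n; rewrite normr_ge0 fh.
- exact: cvg_cst.
- by rewrite -[X in _ --> X](mulr0 C); apply: cvgM => //; exact: cvg_cst.
Qed.

(** The comparison function [g] has an explicit bounded primitive, hence is integrable. Dominating
    every [p * w] by a multiple of [g] gives all moments at once, and reduces the boundary terms to
    the limits of [sigma * g]. *)
Lemma pearson_weight_dominated (u v : nat -> R) I w g G (M : R) (sigma tau : {poly R}) :
  exhausts u v I ->
  (forall x, I x -> 0 < w x) ->
  (forall x, I x -> {for x, continuous w}) ->
  (forall x, I x -> is_derive x 1 (fun y => sigma.[y] * w y) (tau.[x] * w x)) ->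
  (forall x, I x -> {for x, continuous g}) ->
  (forall x, I x -> is_derive x 1 G (g x)) ->
  (forall x, I x -> 0 <= g x) ->
  (forall x, I x -> `|G x| <= M) ->
  (forall p, exists C, forall x, I x -> `|p.[x] * w x| <= C * g x) ->
  sigma.[u n] * g (u n) @[n --> \oo] --> 0 ->
  sigma.[v n] * g (v n) @[n --> \oo] --> 0 ->
  pearson_weight I w sigma tau.
Proof.
move=> e w0 cw dw cg dG g0 GM wg su sv.
have cpw p x : I x -> {for x, continuous (fun y => p.[y] * w y)}.
  by move=> Ix; apply: cvgM; [exact: continuous_horner|exact: cw].
have mI := exhausts_measurable e.
have ig := integrable_bounded_primitive e cg dG g0 GM.
have ipw p : mu.-integrable I (fun x => (p.[x] * w x)%:E).
  have [C pC] := wg p.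
  apply: (integrable_dominated e (@cpw p) (g := fun x => C * g x)) => //.
  by have := @integrableZl _ _ _ mu I mI C _ ig.
split => // r.
(* The boundary term is at most [C] times the absolute value of [sigma * g], where [C] is the
   domination constant of [r]. *)
have sr (t : nat -> R) : (forall n, I (t n)) -> sigma.[t n] * g (t n) @[n --> \oo] --> 0 ->
    r.[t n] * (sigma.[t n] * w (t n)) @[n --> \oo] --> 0.
  move=> It st; have [C rC] := wg r.
  apply: (@cvg0_dominated _ (fun n => `|sigma.[t n] * g (t n)|) C).
    move=> n; rewrite mulrCA !(normrM sigma.[t n]) mulrCA ler_wpM2l//.
    by rewrite (ger0_norm (g0 _ (It n))) rC.
  exact/norm_cvg0P.
have Iu n : I (u n).
  have [_ _ /(_ n) uv _] := e.
  by apply: (exhausts_sub (n := n) e); rewrite /= in_itv/= lexx ltW.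
have Iv n : I (v n).
  have [_ _ /(_ n) uv _] := e.
  by apply: (exhausts_sub (n := n) e); rewrite /= in_itv/= lexx ltW.
apply: (integral_derivative_eq0 e (F := fun x => r.[x] * (sigma.[x] * w x))).
- exact: cpw.
- exact: ipw.
- move=> x Ix; have dwx := dw _ Ix.
  apply: trigger_derive.
  by rewrite /GRing.scale/= hornerD !hornerM; ring.
- exact: sr.
- exact: sr.
Qed.

(** A single term of the exponential series at a nonnegative point is at most the whole sum. *)
Lemma exprn_le_expR (x : R) n : `|x| ^+ n <= n`!%:R * expR `|x|.
Proof.
case: n => [|n].
  by rewrite expr0 fact0 mul1r -expR0 ler_expR normr_ge0.
have := expR_ge1Dxn n (normr_ge0 x).
rewrite -ler_pdivrMl ?ltr0n ?fact_gt0// => h; rewrite mulrC.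
by apply: le_trans h; rewrite lerDr.
Qed.

Lemma horner_le_expR p : exists2 C : R, 0 <= C & forall x, `|p.[x]| <= C * expR `|x|.
Proof.
exists (\sum_(i < size p) `|p`_i| * i`!%:R).
  by apply: sumr_ge0 => i _; rewrite mulr_ge0.
move=> x; rewrite horner_coef mulr_suml (le_trans (ler_norm_sum _ _ _))//.
apply: ler_sum => i _; rewrite normrM normrX -mulrA ler_wpM2l//.
exact: exprn_le_expR.
Qed.

Lemma cvg_harmonicS k : (n + k).+1%:R^-1 @[n --> \oo] --> (0 : R).
Proof.
have := @cvg_harmonic R; rewrite -(cvg_shiftn k).
exact.
Qed.

Lemma cvg_harmonicS_powR k (a : R) : 0 < a ->
  ((n + k).+1%:R^-1 `^ a) @[n --> \oo] --> (0 : R).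
Proof.
move=> a0; apply: (cvg_comp _ _ _ (powR_cvg0 a0)).
move=> A [e /= e0 eA].
have /cvgrPdist_lt/(_ _ e0) := cvg_harmonicS k.
apply: filterS => n ne; apply: eA; first by rewrite /ball_/=.
by rewrite invr_gt0.
Qed.

Lemma powR_mulVr (x a : R) : 0 < x -> x * x `^ (a - 1) = x `^ a.
Proof.
move=> x0; rewrite powRB ?(gt_eqF x0) ?implybT// powRr1 ?ltW//.
by rewrite mulrCA mulfV ?mulr1 ?gt_eqF.
Qed.

End pearson.

(** * The Hermite, Laguerre and Jacobi weights satisfy the Pearson equation *)

Section weights.
Variable R : realType.
Implicit Types p : {poly R}.

Lemma exhaustsT : exhausts (fun n => - n.+1%:R) (fun n => n.+1%:R) [set: R].
Proof.
split.
- by move=> m n mn; rewrite lerN2 ler_nat.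
- by move=> m n mn; rewrite ler_nat.
- by move=> n; rewrite (@lt_trans _ _ 0)// oppr_lt0.
- apply/seteqP; split => // x _.
  exists (Num.bound x) => //=; rewrite in_itv/= -ler_norml.
  have := archi_boundP (normr_ge0 x); rewrite /Num.bound normr_id => /ltW h.
  by rewrite (le_trans h)// ler_nat.
Qed.

Lemma exhausts0y :
  exhausts (fun n => n.+1%:R^-1) (fun n => n.+2%:R) (`]0, +oo[%classic : set R).
Proof.
split.
- by move=> m n mn; rewrite lef_pV2 ?posrE// ler_nat.
- by move=> m n mn; rewrite ler_nat.
- move=> n; rewrite (@le_lt_trans _ _ 1)// ?ltr1n//.
  by rewrite invf_le1// ler1n.
- apply/seteqP; split => x /=; last first.
    by move=> [n _ /=]; rewrite !in_itv/= andbT => /andP[+ _]; apply: lt_le_trans.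
  rewrite in_itv/= andbT => x0.
  (* An integer above [x + x^-1] exceeds both [x] and [x^-1], so one index serves both endpoints. *)
  have xx0 : 0 < x + x^-1 by rewrite addr_gt0// invr_gt0.
  have /ltW := archi_boundP (ltW xx0); set k := Num.bound _ => kx.
  exists k => //=; rewrite in_itv/=; apply/andP; split.
    rewrite -[leRHS]invrK lef_pV2 ?posrE ?invr_gt0//.
    apply: (@le_trans _ _ k%:R); last by rewrite ler_nat.
    by apply: le_trans kx; rewrite lerDr ltW.
  apply: (@le_trans _ _ k%:R); last by rewrite ler_nat leqW.
  by apply: le_trans kx; rewrite lerDl invr_ge0 ltW.
Qed.

Lemma exhaustsN11 : exhausts (fun n => - (1 - n.+2%:R^-1)) (fun n => 1 - n.+2%:R^-1)
  (`]-1, 1[%classic : set R).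
Proof.
split.
- by move=> m n mn; rewrite lerN2 lerD2l lerN2 lef_pV2 ?posrE// ler_nat.
- by move=> m n mn; rewrite lerD2l lerN2 lef_pV2 ?posrE// ler_nat.
- move=> n; rewrite gt0_cp// subr_gt0 invf_lt1// ltr1n//.
- apply/seteqP; split => x /=; last first.
    move=> [n _ /=]; rewrite !in_itv/= -ler_norml -ltr_norml.
    by move=> /le_lt_trans; apply; rewrite ltrBlDr ltrDl.
  rewrite in_itv/= -ltr_norml => x1.
  have x0 : 0 < (1 - `|x|)^-1 by rewrite invr_gt0 subr_gt0.
  have /ltW := archi_boundP (ltW x0); set k := Num.bound _ => kx.
  exists k => //=; rewrite in_itv/= -ler_norml lerBrDr -lerBrDl.
  rewrite -[leRHS]invrK lef_pV2 ?posrE//.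
  by rewrite (le_trans kx)// ler_nat -addn2 leq_addr.
Qed.

(** The comparison function is the derivative of the arctangent, whose absolute value is at most
    [pi / 2]. *)
Lemma pearson_weight_herm (b : R) :
  pearson_weight [set: R] (w_herm b) 1 ((2 * b)%:P - 2%:P * 'X).
Proof.
apply: (pearson_weight_dominated (u := fun n => - n.+1%:R) (v := fun n => n.+1%:R)
   (g := fun x => (1 + x ^+ 2)^-1) (G := @atan R) (M := pi / 2) exhaustsT).
- by move=> x _; exact: expR_gt0.
- move=> x _; apply/differentiable_continuous/derivable1_diffP.
  rewrite /w_herm; exact: ex_derive.
- move=> x _; apply: trigger_derive.
  by rewrite /w_herm /GRing.scale/= -polyC1 derivC hornerD hornerN hornerM !hornerC hornerX; ring.
- move=> x _; apply: cvgV; first by rewrite gt_eqF// ltr_pwDl// sqr_ge0.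
  by apply: cvgD; [exact: cvg_cst|exact: exprn_continuous].
- by move=> x _; rewrite invr_ge0 addr_ge0// sqr_ge0.
- by move=> x _; rewrite ler_norml (ltW (atan_gtNpi2 x)) ltW// atan_ltpi2.
(* Dividing by [g] multiplies [p] by [1 + x ^+ 2], and the product is at most [C * expR |x|]. The
   exponent left, [|x| - x ^+ 2 + 2 * b * x], is at most [(2 * |b| + 1) * |x| - |x| ^+ 2], hence at
   most [(2 * |b| + 1) ^+ 2]. *)
- move=> p; have [C C0 pC] := horner_le_expR (p * (1 + 'X ^+ 2)).
  exists (C * expR ((2 * `|b| + 1) ^+ 2)) => x _.
  rewrite ler_pdivlMr ?ltr_pwDl ?sqr_ge0//.
  rewrite normrM (ger0_norm (expR_ge0 _)) mulrAC.
  have := pC x; rewrite hornerM hornerD hornerXn hornerC normrM.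
  rewrite (@ger0_norm _ (1 + x ^+ 2)) ?addr_ge0 ?sqr_ge0// => h.
  apply: le_trans (ler_wpM2r (expR_ge0 _) h) _.
  rewrite -[leLHS]mulrA ler_wpM2l// -expRD ler_expR.
  have : b * x <= `|b| * `|x| by rewrite -normrM ler_norm.
  have := normr_ge0 b; have := normr_ge0 x; rewrite -(real_normK (num_real x)).
  by move: `|x| `|b| => y c; nra.
- under eq_fun do rewrite hornerC mul1r sqrrN.
  apply: (@cvg0_dominated _ _ (fun n => (n + 0).+1%:R^-1) 1); last exact: cvg_harmonicS.
  move=> n; rewrite addn0 mul1r ger0_norm ?invr_ge0 ?addr_ge0 ?sqr_ge0//.
  rewrite lef_pV2 ?posrE ?ltr_pwDl ?sqr_ge0//.
  rewrite (@le_trans _ _ (n.+1%:R^+2))// ?lerDr// expr2 ler_peMr// ler1n//.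
- under eq_fun do rewrite hornerC mul1r.
  apply: (@cvg0_dominated _ _ (fun n => (n + 0).+1%:R^-1) 1); last exact: cvg_harmonicS.
  move=> n; rewrite addn0 mul1r ger0_norm ?invr_ge0 ?addr_ge0 ?sqr_ge0//.
  rewrite lef_pV2 ?posrE ?ltr_pwDl ?sqr_ge0//.
  rewrite (@le_trans _ _ (n.+1%:R^+2))// ?lerDr// expr2 ler_peMr// ler1n//.
Qed.

Lemma continuous_powR (a x : R) : 0 < x -> {for x, continuous (fun y => y `^ a)}.
Proof.
move=> x0; apply/differentiable_continuous/derivable1_diffP.
by apply: derivable_powR; rewrite in_itv/= x0.
Qed.

Lemma is_derive_powR1_comp (a : R) (h : R -> R) (x dh : R) : 0 < h x -> -1 < a ->
  is_derive x 1 h dh ->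
  is_derive x 1 (fun y => (h y) `^ (a + 1) / (a + 1)) (h x `^ a * dh).
Proof.
move=> hx a1 dhx; have a0 : a + 1 != 0 by rewrite gt_eqF// -ltrBlDr sub0r.
have dp := is_derive1_powR (a + 1) hx.
have dc := @is_derive1_comp _ (fun y => y `^ (a + 1)) h x _ _ dp dhx.
apply: trigger_derive; rewrite /GRing.scale/= addrK.
by field.
Qed.

(** The substitution [y = x / (1 + x)] maps the half-line into the unit interval and has derivative
    [(1 + x) ^- 2]. Hence [g = y ^ a * y'] has the primitive [y ^ (a + 1) / (a + 1)], bounded by
    [(a + 1)^-1]; it behaves like [x ^ a] at 0 and like [x ^- 2] at infinity. *)
Lemma pearson_weight_lag (a : R) : -1 < a ->
  pearson_weight `]0, +oo[%classic (w_lag a) 'X ((a + 1)%:P - 'X).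
Proof.
move=> a1; have a0 : 0 < a + 1 by rewrite -ltrBlDr sub0r.
have Ipos (x : R) : `]0, +oo[%classic x -> 0 < x by rewrite /= in_itv/= andbT.
have y0 (x : R) : 0 < x -> 0 < x / (1 + x) by move=> x0; rewrite divr_gt0// addr_gt0.
have y1 (x : R) : 0 < x -> x / (1 + x) <= 1.
  by move=> x0; rewrite ler_pdivrMr ?addr_gt0// mul1r lerDr.
have x1_neq0 (x : R) : 0 < x -> 1 + x != 0 by move=> x0; rewrite gt_eqF// addr_gt0.
have dy (x : R) : 0 < x -> is_derive x 1 (fun y => y / (1 + y)) ((1 + x) ^+ 2)^-1.
  move=> x0; have xn := x1_neq0 _ x0.
  apply: trigger_derive; rewrite /GRing.scale/=.
  by field.
have p1 : 1 `^ (a + 1) = 1 by rewrite powR1.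
(* In this form both boundary limits are visible: the power of [y] vanishes at 0, the factor
   [(1 + x)^-1] at infinity. *)
have sgE (x : R) : 0 < x ->
    x * ((x / (1 + x)) `^ a * ((1 + x) ^+ 2)^-1) = (x / (1 + x)) `^ (a + 1) * (1 + x)^-1.
  move=> x0; rewrite -(powR_mulVr (a + 1) (y0 _ x0)) addrK.
  by field; exact: x1_neq0.
apply: (pearson_weight_dominated (u := fun n => n.+1%:R^-1) (v := fun n => n.+2%:R)
   (g := fun x => (x / (1 + x)) `^ a * ((1 + x) ^+ 2)^-1)
   (G := fun x => (x / (1 + x)) `^ (a + 1) / (a + 1)) (M := (a + 1)^-1) exhausts0y).
- by move=> x /Ipos x0; rewrite mulr_gt0 ?expR_gt0 ?powR_gt0.
- move=> x /Ipos x0; apply: cvgM; last exact: continuous_powR.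
  apply: (@continuous_comp _ _ _ (fun y : R => - y) expR); last exact: continuous_expR.
  exact: continuousN.
- move=> x /Ipos x0; have := is_derive1_powR a x0 => dp.
  rewrite /w_lag; under eq_fun do rewrite hornerX.
  apply: trigger_derive; rewrite /GRing.scale/= hornerD hornerN hornerC hornerX.
  have := powR_mulVr a x0; move: (x `^ (a - 1)) (x `^ a) => s _ <-; ring.
- move=> x /Ipos x0; apply: cvgM.
    apply: (@continuous_comp _ _ _ (fun y : R => y / (1 + y)) (fun y => y `^ a)).
      apply/differentiable_continuous/derivable1_diffP.
      by have := dy _ x0.
    by apply: continuous_powR; exact: y0.
  apply: cvgV; first by rewrite expf_neq0// x1_neq0.
  by apply: cvgM; apply: cvgD; [exact: cvg_cst|exact: cvg_id|exact: cvg_cst|exact: cvg_id].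
- move=> x /Ipos x0; apply: is_derive_powR1_comp => //; first exact: y0.
  exact: dy.
- by move=> x /Ipos x0; rewrite mulr_ge0 ?powR_ge0// invr_ge0 exprn_ge0// addr_ge0// ltW.
- move=> x /Ipos x0; rewrite ger0_norm ?mulr_ge0 ?powR_ge0 ?invr_ge0 ?(ltW a0)//.
  rewrite ler_piMl ?invr_ge0 ?(ltW a0)// -[leRHS]p1.
  by rewrite ge0_ler_powR// ?nnegrE ?y1 ?(ltW a0) ?(ltW (y0 _ x0)).
(* As [x = y * (1 + x)] and [m] exceeds [|a|], one has [x ^ a <= y ^ a * (1 + x) ^ m]. Two more
   powers of [1 + x] compensate the denominator of [g], and the exponential absorbs the resulting
   polynomial. *)
- move=> p; pose m := Num.bound `|a|.
  have [C C0 pC] := horner_le_expR (p * (1 + 'X) ^+ (m + 2)).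
  exists C => x /Ipos x0.
  have x10 : 0 < 1 + x by rewrite addr_gt0.
  have xa : x `^ a <= (x / (1 + x)) `^ a * (1 + x) ^+ m.
    have -> : x `^ a = (x / (1 + x)) `^ a * (1 + x) `^ a.
      by rewrite -powRM ?divfK ?x1_neq0// ltW// y0.
    rewrite ler_wpM2l ?powR_ge0// -powR_mulrn ?(ltW x10)// ler_powR//.
      by rewrite lerDl (ltW x0).
    by rewrite (le_trans (ler_norm _))// ltW// archi_boundP.
  have h : `|p.[x]| * (1 + x) ^+ (m + 2) * expR (- x) <= C.
    have := pC x; rewrite hornerM horner_exp hornerD hornerX hornerC normrM normrX.
    rewrite (gtr0_norm x10) (gtr0_norm x0) => h.
    by rewrite expRN ler_pdivrMr ?expR_gt0.
  rewrite normrM (@ger0_norm _ (w_lag _ _)) ?mulr_ge0 ?expR_ge0 ?powR_ge0//.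
  apply: le_trans (ler_wpM2l (normr_ge0 _) (ler_wpM2l (expR_ge0 _) xa)) _.
  have g0 : 0 <= (x / (1 + x)) `^ a * ((1 + x) ^+ 2)^-1.
    by rewrite mulr_ge0 ?powR_ge0// invr_ge0 exprn_ge0// ltW.
  apply: le_trans (ler_wpM2r g0 h); rewrite le_eqVlt; apply/orP; left; apply/eqP.
  by rewrite exprD; field; exact: x1_neq0.
- apply: (@cvg0_dominated _ _ (fun n => (n + 1).+1%:R^-1 `^ (a + 1)) 1); last first.
    exact: cvg_harmonicS_powR.
  move=> n; rewrite hornerX sgE ?invr_gt0// mul1r.
  (* At the left endpoint [x = 1 / (n + 1)] the variable [y] equals [1 / (n + 2)]. *)
  have -> : n.+1%:R^-1 / (1 + n.+1%:R^-1) = (n + 1).+1%:R^-1 :> R.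
    rewrite addn1 -[in RHS]natr1; have : 0 < n.+1%:R :> R by [].
    by move: n.+1%:R => t t0; field; rewrite !gt_eqF ?addr_gt0.
  rewrite ger0_norm ?mulr_ge0 ?powR_ge0 ?invr_ge0 ?addr_ge0//.
  by rewrite ler_piMr ?powR_ge0// invf_le1 ?lerDl// addr_gt0.
- apply: (@cvg0_dominated _ _ (fun n => (n + 2).+1%:R^-1) 1); last exact: cvg_harmonicS.
  move=> n; have -> : (n + 2).+1%:R = 1 + n.+2%:R :> R by rewrite addn2 -natr1 addrC.
  have : 0 < n.+2%:R :> R by []; move: n.+2%:R => t t0; rewrite hornerX sgE// mul1r.
  have it0 : 0 <= (1 + t)^-1 by rewrite invr_ge0 addr_ge0// ltW.
  rewrite ger0_norm ?mulr_ge0 ?powR_ge0// ler_piMl// -[leRHS]p1.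
  by rewrite ge0_ler_powR// ?nnegrE ?y1 ?(ltW a0)// ltW// y0.
Qed.

(** The product of the two powers is dominated by a multiple of their sum, because on each half of
    the interval one factor is bounded. The sum has an explicit primitive, bounded since [a + 1] and
    [b + 1] are positive. *)
Lemma pearson_weight_jac (a b : R) : -1 < a -> -1 < b ->
  pearson_weight `]-1, 1[%classic (w_jac a b) (1 - 'X ^+ 2)
    ((b - a)%:P - (a + b + 2)%:P * 'X).
Proof.
move=> a1 b1.
have a0 : 0 < a + 1 by rewrite -ltrBlDr sub0r.
have b0 : 0 < b + 1 by rewrite -ltrBlDr sub0r.
have Im (x : R) : `]-1, 1[%classic x -> 0 < 1 - x.
  by rewrite /= in_itv/= subr_gt0 => /andP[].
have Ip (x : R) : `]-1, 1[%classic x -> 0 < 1 + x.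
  by rewrite /= in_itv/= -ltrBlDl sub0r => /andP[].
have Ia (x : R) : `]-1, 1[%classic x -> `|x| <= 1.
  by rewrite /= in_itv/= -ltr_norml => /ltW.
have cm (x : R) : `]-1, 1[%classic x -> {for x, continuous (fun y : R => (1 - y) `^ a)}.
  move=> Ix; apply: (@continuous_comp _ _ _ (fun y : R => 1 - y) (fun y => y `^ a)).
    by apply: cvgB; [exact: cvg_cst|exact: cvg_id].
  by apply: continuous_powR; exact: Im.
have cp (x : R) : `]-1, 1[%classic x -> {for x, continuous (fun y : R => (1 + y) `^ b)}.
  move=> Ix; apply: (@continuous_comp _ _ _ (fun y : R => 1 + y) (fun y => y `^ b)).
    by apply: cvgD; [exact: cvg_cst|exact: cvg_id].
  by apply: continuous_powR; exact: Ip.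
have dm (x : R) : is_derive x 1 (fun y : R => 1 - y) (-1).
  by apply: trigger_derive; rewrite add0r mul1r.
have dp (x : R) : is_derive x 1 (fun y : R => 1 + y) 1.
  by apply: trigger_derive; rewrite /= add0r ?mulr1.
have inv01 n : 0 < n.+2%:R^-1 :> R /\ n.+2%:R^-1 <= 1 :> R.
  by rewrite invr_gt0 invf_le1 ?ler1n.
(* Here [s] is the distance to one endpoint and [2 - s] to the other, so that [sigma = s * (2 - s)].
   Exchanging the roles of [a] and [b] covers both endpoints. *)
have end_bound (c d s : R) : 0 < s -> s <= 1 -> 0 < d + 1 ->
    `|(s `^ c + (2 - s) `^ d) * (s * (2 - s))| <= (2 + 2 `^ (d + 1)) * (s `^ (c + 1) + s).
  move=> s0 s1 d0; have s2 : 0 < 2 - s by lra.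
  have -> : (s `^ c + (2 - s) `^ d) * (s * (2 - s))
      = (2 - s) * s `^ (c + 1) + (2 - s) `^ (d + 1) * s.
    by rewrite -(powR_mulVr (c + 1) s0) -(powR_mulVr (d + 1) s2) !addrK; ring.
  have sc : 0 <= s `^ (c + 1) by exact: powR_ge0.
  have sd : 0 <= (2 - s) `^ (d + 1) by exact: powR_ge0.
  have : (2 - s) `^ (d + 1) <= 2 `^ (d + 1).
    by rewrite ge0_ler_powR// ?nnegrE ?(ltW d0)//; lra.
  rewrite ger0_norm; last by rewrite addr_ge0// mulr_ge0// ltW.
  move: sc sd; move: (s `^ (c + 1)) ((2 - s) `^ (d + 1)) (2 `^ (d + 1)) => x y z *; nra.
apply: (pearson_weight_dominated
   (u := fun n => - (1 - n.+2%:R^-1)) (v := fun n => 1 - n.+2%:R^-1)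
   (g := fun x => (1 - x) `^ a + (1 + x) `^ b)
   (G := fun x => (1 + x) `^ (b + 1) / (b + 1) - (1 - x) `^ (a + 1) / (a + 1))
   (M := 2 `^ (b + 1) / (b + 1) + 2 `^ (a + 1) / (a + 1)) exhaustsN11).
- by move=> x Ix; rewrite mulr_gt0 ?powR_gt0 ?Im ?Ip.
- by move=> x Ix; apply: cvgM; [exact: cm|exact: cp].
- move=> x Ix; rewrite /w_jac.
  have xm := Im _ Ix; have xp := Ip _ Ix.
  have dma := @is_derive1_comp _ (fun y => y `^ a) (fun y => 1 - y) x _ _
    (is_derive1_powR a xm) (dm x).
  have dpb := @is_derive1_comp _ (fun y => y `^ b) (fun y => 1 + y) x _ _
    (is_derive1_powR b xp) (dp x).
  (* Both powers are displayed as compositions, the form in which [dma] and [dpb] give their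
     derivatives. *)
  have -> : (fun y => (1 - 'X ^+ 2).[y] * ((1 - y) `^ a * (1 + y) `^ b)) =
    (fun y => (1 - 'X ^+ 2).[y] * (((fun y => y `^ a) \o (fun y => 1 - y)) y *
                                   ((fun y => y `^ b) \o (fun y => 1 + y)) y)) by [].
  apply: trigger_derive.
  have -> : (1 - 'X ^+ 2)^`() = - ('X *+ 2) :> {poly R}.
    by rewrite derivB derivXn -polyC1 derivC sub0r expr1.
  rewrite /GRing.scale/= hornerN hornerMn !hornerD !hornerN hornerXn hornerM !hornerC hornerX.
  rewrite -!(powR_mulVr a xm) -!(powR_mulVr b xp).
  by move: ((1 - x) `^ (a - 1)) ((1 + x) `^ (b - 1)) => s t; ring.
- by move=> x Ix; apply: cvgD; [exact: cm|exact: cp].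
- move=> x Ix; have xm := Im _ Ix; have xp := Ip _ Ix.
  have dma := is_derive_powR1_comp (h := fun y => 1 - y) xm a1 (dm x).
  have dpb := is_derive_powR1_comp (h := fun y => 1 + y) xp b1 (dp x).
  by apply: trigger_derive; ring.
- by move=> x _; rewrite addr_ge0 ?powR_ge0.
- move=> x Ix; have xm := Im _ Ix; have xp := Ip _ Ix.
  have := Ia _ Ix; rewrite ler_norml => /andP[x1 x2].
  rewrite (le_trans (ler_normB _ _))// lerD//;
    rewrite ger0_norm ?mulr_ge0 ?powR_ge0 ?invr_ge0 ?(ltW a0) ?(ltW b0)//;
    rewrite ler_pM2r ?invr_gt0// ge0_ler_powR// ?nnegrE ?(ltW a0) ?(ltW b0)//; lra.
- move=> p; have [C C0 pC] := horner_le_expR p.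
  (* As [|x| <= 1], the polynomial is at most [C * expR 1]. The remaining factor bounds the power
     whose base lies between 1 and 2: that of [1 + x] when [0 <= x], that of [1 - x] otherwise. *)
  exists (C * expR 1 * (2 `^ `|a| + 2 `^ `|b|)) => x Ix.
  have xm := Im _ Ix; have xp := Ip _ Ix.
  have xa : 0 <= (1 - x) `^ a by exact: powR_ge0.
  have xb : 0 <= (1 + x) `^ b by exact: powR_ge0.
  have pw (c y : R) : 1 <= y <= 2 -> y `^ c <= 2 `^ `|c|.
    move=> /andP[y1 y2]; apply: (@le_trans _ _ (y `^ `|c|)).
      by rewrite ler_powR// ler_norm.
    by rewrite ge0_ler_powR// ?nnegrE//; lra.
  have pp (c : R) : 0 <= 2 `^ `|c| :> R by exact: powR_ge0.
  rewrite normrM (@ger0_norm _ (w_jac _ _ _)) ?mulr_ge0// -[leRHS]mulrA ler_pM//.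
    by rewrite mulr_ge0.
    rewrite (le_trans (pC x))// ler_wpM2l// ler_expR; exact: Ia.
  rewrite /w_jac; have := Ia _ Ix; rewrite ler_norml => /andP[x1 x2].
  have := pp a; have := pp b.
  case: (leP 0 x) => x0.
    have : (1 + x) `^ b <= 2 `^ `|b| by apply: pw; lra.
    move: xa xb; move: ((1 - x) `^ a) ((1 + x) `^ b) (2 `^ `|a|) (2 `^ `|b|).
    by move=> s t k l *; nra.
  have : (1 - x) `^ a <= 2 `^ `|a| by apply: pw; lra.
  move: xa xb; move: ((1 - x) `^ a) ((1 + x) `^ b) (2 `^ `|a|) (2 `^ `|b|).
  by move=> s t k l *; nra.
- apply: (@cvg0_dominated _ _ (fun n => (n + 1).+1%:R^-1 `^ (b + 1) + (n + 1).+1%:R^-1)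
    (2 + 2 `^ (a + 1))).
    move=> n; rewrite addrC; have [] := inv01 n; rewrite addn1; move: n.+2%:R^-1 => s s0 s1.
    have := end_bound b a s s0 s1 a0; congr (`|_| <= _).
    rewrite hornerD hornerN hornerXn hornerC sqrrN [RHS]mulrC; congr (_ * _); last by ring.
    by rewrite addrC opprK; congr (_ `^ _ + _ `^ _); ring.
  rewrite -[X in _ --> X](addr0 (0 : R)).
  by apply: cvgD; [exact: cvg_harmonicS_powR|exact: cvg_harmonicS].
- apply: (@cvg0_dominated _ _ (fun n => (n + 1).+1%:R^-1 `^ (a + 1) + (n + 1).+1%:R^-1)
    (2 + 2 `^ (b + 1))).
    move=> n; have [] := inv01 n; rewrite addn1; move: n.+2%:R^-1 => s s0 s1.
    have := end_bound a b s s0 s1 b0; congr (`|_| <= _).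
    rewrite hornerD hornerN hornerXn hornerC [RHS]mulrC; congr (_ * _); last by ring.
    by congr (_ `^ _ + _ `^ _); ring.
  rewrite -[X in _ --> X](addr0 (0 : R)).
  by apply: cvgD; [exact: cvg_harmonicS_powR|exact: cvg_harmonicS].
Qed.

End weights.

(** * The moment functional of a scalar weight: symmetry and positivity *)

Section functional.
Variables (R : realType) (I : set R) (w : R -> R) (sigma tau : {poly R}).
Hypotheses (mI : measurable I) (hw : pearson_weight I w sigma tau).
Implicit Types p q : {poly R}.
Notation mu := (@lebesgue_measure R).

Definition moment p : R := \int[mu]_(x in I) (p.[x] * w x).

Lemma integrable_moment p : mu.-integrable I (EFin \o (fun x => p.[x] * w x)).
Proof. by have [_ h _] := hw; exact: h. Qed.

Lemma momentE p : (\int[mu]_(x in I) (p.[x] * w x)%:E = (moment p)%:E)%E.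
Proof.
rewrite /moment /Rintegral fineK//.
by apply: integrable_fin_num => //; exact: integrable_moment.
Qed.

Lemma momentD p q : moment (p + q) = moment p + moment q.
Proof.
rewrite /moment -RintegralD//; try exact: integrable_moment.
by apply: eq_Rintegral => x _; rewrite hornerD mulrDl.
Qed.

Lemma momentZ c p : moment (c *: p) = c * moment p.
Proof.
rewrite /moment -RintegralZl//; last exact: integrable_moment.
by apply: eq_Rintegral => x _; rewrite hornerZ mulrA.
Qed.

Lemma momentN p : moment (- p) = - moment p.
Proof. by rewrite -scaleN1r momentZ mulN1r. Qed.

Lemma moment_sum J (s : seq J) (F : J -> {poly R}) :
  moment (\sum_(j <- s) F j) = \sum_(j <- s) moment (F j).
Proof.
apply: (big_morph moment momentD).
by rewrite -(scale0r 0) momentZ mul0r.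
Qed.

Lemma moment_pearson p : moment (tau * p + sigma * p^`()) = 0.
Proof. by have [_ _ h] := hw; apply: EFin_inj; rewrite -momentE. Qed.

(* Both sides differ by the Pearson identity applied to [p^`() * q - p * q^`()]. *)
Lemma moment_sym (c : R) p q :
  moment ((sigma * p^`()^`() + tau * p^`() + c *: p) * q) =
  moment (p * (sigma * q^`()^`() + tau * q^`() + c *: q)).
Proof.
apply/eqP; rewrite -subr_eq0 -momentN -momentD; apply/eqP.
rewrite -[RHS](moment_pearson (p^`() * q - p * q^`())); congr moment.
by rewrite derivB !derivM -!mul_polyC; ring.
Qed.

Lemma moment_sqr_ge0 p : 0 <= moment (p * p).
Proof.
have [w0 _ _] := hw; apply: Rintegral_ge0 => x Ix.
by rewrite hornerM -expr2 mulr_ge0 ?sqr_ge0// ltW// w0.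
Qed.

Hypothesis I0 : mu I != 0%E.

(** A nonnegative integrand with zero integral vanishes almost everywhere. Since [w] is positive,
    [I] is covered by a null set and the roots of [p]; for nonzero [p] these are finitely many, and
    [I] would be null. *)
Lemma moment_sqr_eq0 p : moment (p * p) = 0 -> p = 0.
Proof.
have [w0 _ _] := hw => pp0; apply: (contraNeq _ I0) => p0; apply/eqP.
(* An infinite set of roots would contain [size p] distinct ones, too many for a nonzero
   polynomial. *)
have finite_roots : finite_set [set x | p.[x] = 0].
  apply: contrapT => /(infinite_set_fset (size p)) [B Bp] /=.
  apply/negP; rewrite -ltnNge; apply: max_poly_roots => //; last exact: finmap.fset_uniq.
  by apply/allP => x xB; apply/rootP; exact: Bp.
have /integrableP[mf _] := integrable_moment (p * p).
have : (\int[mu]_(x in I) `|(EFin \o (fun x => (p * p).[x] * w x)%R) x| = 0)%E.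
  transitivity (moment (p * p))%:E; last by rewrite pp0.
  rewrite -momentE; apply: eq_integral => x; rewrite inE => /w0 wx /=.
  by rewrite hornerM ger0_norm// mulr_ge0 ?(ltW wx)// -expr2 sqr_ge0.
move=> /(ae_eq_integral_abs mu mI mf) IZ.
have roots0 : mu.-negligible [set x | p.[x] = 0].
  apply/negligibleP.
    apply: countable_measurable; first exact: (@measurable_set1 R).
    exact: finite_set_countable.
  exact/countable_lebesgue_measure0/finite_set_countable.
apply/negligibleP => //; apply: negligibleS (negligibleU IZ roots0).
move=> x Ix; have [px|/eqP px] := pselect (p.[x] = 0); [by right|left => /= h].
have /eqP := h Ix; rewrite eqe hornerM.
by rewrite !mulf_eq0 (negPf px) gt_eqF// w0.
Qed.

End functional.

(** * Matrix weights *)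

Section matrix.
Variables (R : realType) (N : nat).
Implicit Types (P Q : mpoly R N) (M : 'M[R]_N) (D : diffop R N).

Lemma diagN_row (d : nat -> R) : diagN N d = diag_mx (\row_j d j.+1).
Proof.
by apply/matrixP => r s; rewrite !mxE; case: eqP => [->|_]; rewrite ?mul1r ?mul0r.
Qed.

Lemma mx_derivD P Q : mx_deriv (P + Q) = mx_deriv P + mx_deriv Q.
Proof. by apply/matrixP => i j; rewrite !mxE derivD. Qed.

Lemma mx_derivM P Q : mx_deriv (P *m Q) = mx_deriv P *m Q + P *m mx_deriv Q.
Proof.
apply/matrixP => i j; rewrite !mxE raddf_sum -big_split; apply: eq_bigr => k _.
by rewrite /= derivM !mxE.
Qed.

Lemma mx_deriv_cmx M : mx_deriv (cmx M) = 0.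
Proof. by apply/matrixP => i j; rewrite !mxE derivC. Qed.

Lemma mx_evalE P x i j : mx_eval P x i j = (P i j).[x].
Proof. by rewrite mxE. Qed.

Lemma mx_evalM P Q x : mx_eval (P *m Q) x = mx_eval P x *m mx_eval Q x.
Proof.
apply/matrixP => i j; rewrite !mxE horner_sum; apply: eq_bigr => k _.
by rewrite hornerM !mxE.
Qed.

Lemma cmx1 : cmx (1%:M : 'M[R]_N) = 1%:M.
Proof. exact: map_mx1. Qed.

Definition Tpol (a : nat -> R) : mpoly R N := 1%:M + 'X *: cmx (Amx N a).

Lemma mx_eval_Tpol a x : mx_eval (Tpol a) x = Tmx N a x.
Proof.
apply/matrixP => i j; rewrite !mxE hornerD hornerMn hornerM hornerX !hornerC.
by rewrite -mulr_natl mulr1.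
Qed.

Lemma mx_deriv_Tpol a : mx_deriv (Tpol a) = cmx (Amx N a).
Proof.
rewrite mx_derivD -cmx1 mx_deriv_cmx add0r.
by apply/matrixP => i j; rewrite !mxE derivM derivX derivC mulr0 addr0 mul1r.
Qed.

Definition diagp (t : nat -> {poly R}) : mpoly R N := diag_mx (\row_j t j.+1).

(** These equations compare the factors of [P''], [P'] and [P] in [(P . D) T = (P T) . delta], using
    [(P T)' = P' T + P A] and [(P T)'' = P'' T + 2 P' A]. *)
Definition intertwines a (sigma : {poly R}) (tau : nat -> {poly R}) (c : nat -> R) D :=
  [/\ F2 D = sigma *: 1%:M,
      F1 D *m Tpol a = (2%:R * sigma) *: cmx (Amx N a) + Tpol a *m diagp tau &
      F0 D *m Tpol a = cmx (Amx N a) *m diagp tau + Tpol a *m cmx (diagN N c)].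

Lemma act_intertwines a sigma tau c D P : intertwines a sigma tau c D ->
  act P D *m Tpol a = sigma *: mx_deriv (mx_deriv (P *m Tpol a)) +
    mx_deriv (P *m Tpol a) *m diagp tau + (P *m Tpol a) *m cmx (diagN N c).
Proof.
move=> [e2 e1 e0].
have d1 : mx_deriv (P *m Tpol a) = mx_deriv P *m Tpol a + P *m cmx (Amx N a).
  by rewrite mx_derivM mx_deriv_Tpol.
have d2 : mx_deriv (mx_deriv (P *m Tpol a)) = mx_deriv (mx_deriv P) *m Tpol a +
    mx_deriv P *m cmx (Amx N a) + mx_deriv P *m cmx (Amx N a).
  by rewrite d1 mx_derivD !mx_derivM mx_deriv_Tpol mx_deriv_cmx mulmx0 addr0.
rewrite d2 d1 {d1 d2} /act !mulmxDl -!(mulmxA _ _ (Tpol a)) e2 e1 e0.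
move: (Tpol a) => T.
rewrite -scalemxAl mul1mx -!scalemxAr !mulmxDr -!scalemxAr !mulmxA !scalerDr.
by rewrite mulr_natl mulr2n scalerDl !addrA.
Qed.

Lemma act_intertwines_coef a sigma tau c D P i (k : 'I_N) : intertwines a sigma tau c D ->
  let p := (P *m Tpol a) i k in
  (act P D *m Tpol a) i k = sigma * p^`()^`() + tau k.+1 * p^`() + c k.+1 *: p.
Proof.
move=> /act_intertwines -> /=; rewrite mxE mxE mul_mx_diag.
have -> : cmx (diagN N c) = diag_mx (\row_j (c j.+1)%:P).
  by apply/matrixP => r s; rewrite !mxE; case: eqP => [->|_]; rewrite ?mul1r ?mul0r.
rewrite mul_mx_diag; set p := P *m Tpol a; rewrite !mxE.
by rewrite [_ * tau _]mulrC [_ * _%:P]mulrC mul_polyC.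
Qed.

(** Moving [T] onto the polynomials turns [P W Q^T] into [(P T) diag(w) (Q T)^T], a sum over the
    columns of scalar integrands. *)
Lemma ip_moments (I : set R) a w P Q i j : measurable I ->
  (forall k, (k < N)%N -> exists sigma tau, pearson_weight I (w k.+1) sigma tau) ->
  ip I (Wmx N a w) P Q i j =
    (\sum_(k < N) moment I (w k.+1) ((P *m Tpol a) i k * (Q *m Tpol a) j k))%:E.
Proof.
move=> mI hw; rewrite /ip.
transitivity (\int[@lebesgue_measure R]_(x in I)
   (\sum_(k < N) (((P *m Tpol a) i k * (Q *m Tpol a) j k).[x] * w k.+1 x)%:E)%E)%E.
  apply: eq_integral => x _; rewrite sumEFin; congr (_%:E).
  have -> : mx_eval P x *m Wmx N a w x *m (mx_eval Q x)^T =
     mx_eval (P *m Tpol a) x *m diagN N (fun j => w j x) *m (mx_eval (Q *m Tpol a) x)^T.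
    by rewrite !mx_evalM mx_eval_Tpol trmx_mul /Wmx !mulmxA.
  rewrite diagN_row mul_mx_diag mxE; apply: eq_bigr => k _.
  by rewrite [in LHS]mxE [_^T k j]mxE [(\row_ _ _) 0 k]mxE !mx_evalE hornerM mulrAC.
rewrite integral_sum//; last first.
  by move=> k; have [s [t h]] := hw k (ltn_ord k); exact: (integrable_moment h).
rewrite -sumEFin; apply: eq_bigr => k _.
by have [s [t h]] := hw k (ltn_ord k); rewrite (momentE mI h).
Qed.

End matrix.

(** * From the intertwining relation to the eigenvalue equation *)

Section orthogonality.
Variables (R : realType) (N : nat).
Implicit Types (P Q : mpoly R N) (M : 'M[R]_N) (D : diffop R N) (p q : {poly R}).

Lemma size_deriv_leq p m : (size p <= m)%N -> (size p^`() <= m.-1)%N.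
Proof.
have [->|p0] := eqVneq p 0; first by rewrite deriv0 size_poly0.
by have := lt_size_deriv p0; lia.
Qed.

(** The truncated subtraction is harmless: if [m <= d], the first bound forces [p = 0]. *)
Lemma size_mul_leq p q m d : (size p <= m - d)%N -> (size q <= d.+1)%N ->
  (size (p * q)%R <= m)%N.
Proof.
have [->|p0] := eqVneq p 0; first by rewrite mul0r size_poly0.
have : (0 < size p)%N by rewrite size_poly_gt0.
by have := size_polyMleq p q; lia.
Qed.

(** The coefficient of the derivative of order [d] has degree at most [d], so it restores at most
    the degrees lost by differentiating. *)
Lemma act_deg_lt D P m : deg_lt (F2 D) 3 -> deg_lt (F1 D) 2 -> deg_lt (F0 D) 1 ->
  deg_lt P m -> deg_lt (act P D) m.
Proof.
move=> d2 d1 d0 dP i j; rewrite /act !mxE.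
have sum_leq (F : 'I_N -> {poly R}) :
    (forall k, size (F k) <= m)%N -> (size (\sum_k F k)%R <= m)%N.
  by move=> Fm; apply: leq_trans (size_sum _ _ _) _; apply/bigmax_leqP.
rewrite (leq_trans (size_polyD _ _))// geq_max; apply/andP; split.
  rewrite (leq_trans (size_polyD _ _))// geq_max; apply/andP; split.
    apply: sum_leq => k; apply: (@size_mul_leq _ _ _ 2) (d2 k j).
    by rewrite !mxE subn2; do 2 apply: size_deriv_leq.
  apply: sum_leq => k; apply: (@size_mul_leq _ _ _ 1) (d1 k j).
  by rewrite !mxE subn1; apply: size_deriv_leq.
by apply: sum_leq => k; apply: (@size_mul_leq _ _ _ 0) (d0 k j); rewrite subn0.
Qed.

Lemma Amx_eq0 (a : nat -> R) (i j : 'I_N) : odd i || ~~ odd j -> Amx N a i j = 0.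
Proof.
rewrite mxE => ij; case: ifP => [/andP[/eqP e oi]|_]; first by move: ij; rewrite e/= (negPf oi).
by case: ifP => // /andP[/eqP e oj]; move: ij; rewrite e/= oj.
Qed.

(* Entries of [A] vanish unless the row is even and the column odd (0-indexed). *)
Lemma Amx_diag_Amx (a d : nat -> R) : Amx N a *m diagN N d *m Amx N a = 0.
Proof.
rewrite diagN_row; apply/matrixP => i j; rewrite !mxE big1// => k _; rewrite mul_mx_diag mxE.
by case: (boolP (odd k)) => k2; [rewrite (@Amx_eq0 _ k j) ?k2// mulr0|
  rewrite (@Amx_eq0 _ i k) ?k2 ?orbT// !mul0r].
Qed.

Lemma Amx_sqr0 (a : nat -> R) : Amx N a *m Amx N a = 0.
Proof.
rewrite -[RHS](Amx_diag_Amx a (fun=> 1)) -[X in X *m _](mulmx1); congr (_ *m _ *m _).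
by apply/matrixP => r s; rewrite !mxE mulr1.
Qed.

(** Since [A] squares to zero, [T] is invertible over the polynomials, so [Q T = 0] forces
    [Q = 0]. *)
Lemma Tpol_inv (a : nat -> R) : Tpol N a *m (1%:M - 'X *: cmx (Amx N a)) = 1%:M.
Proof.
rewrite /Tpol mulmxBr mulmx1 mulmxDl mul1mx -scalemxAl -scalemxAr.
by rewrite /cmx -map_mxM Amx_sqr0 map_mx0 !scaler0 addr0 addrK.
Qed.

Lemma in_DW_intertwines (I : set R) a (w : nat -> R -> R) sigma tau c D :
  measurable I -> lebesgue_measure I != 0%E ->
  (forall k, (k < N)%N -> pearson_weight I (w k.+1) sigma (tau k.+1)) ->
  intertwines a sigma tau c D ->
  deg_lt (F2 D) 3 -> deg_lt (F1 D) 2 -> deg_lt (F0 D) 1 ->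
  in_DW I (Wmx N a w) D.
Proof.
move=> mI I0 hw hD d2 d1 d0 P hP n.
(* The matrix inner product with real values, so that linear algebra applies to its entries. *)
pose r P Q i j :=
  \sum_(k < N) moment I (w k.+1) ((P *m Tpol N a) i k * (Q *m Tpol N a) j k).
have ipE P' Q i j : ip I (Wmx N a w) P' Q i j = (r P' Q i j)%:E.
  apply: ip_moments => // k kN; exists sigma, (tau k.+1); exact: hw.
have r_sym P' Q i j : r (act P' D) Q i j = r P' (act Q D) i j.
  apply: eq_bigr => k _; rewrite !(act_intertwines_coef _ _ _ hD).
  exact: (moment_sym mI (hw k (ltn_ord k))).
have r_lin P1 M P2 Q i j :
    r (P1 - cmx M *m P2) Q i j = r P1 Q i j - \sum_l M i l * r P2 Q l j.
  rewrite /r; under [X in _ = _ - X]eq_bigr do rewrite mulr_sumr.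
  rewrite exchange_big -sumrB; apply: eq_bigr => k _.
  have hk := hw k (ltn_ord k); rewrite mulmxBl -mulmxA mxE [X in _ + X]mxE [X in _ - X]mxE.
  rewrite mulrBl (momentD mI hk) (momentN mI hk) mulr_suml (moment_sum mI hk).
  congr (_ - _); apply: eq_bigr => l _.
  by rewrite mxE mul_polyC -scalerAl (momentZ mI hk).
(* A diagonal entry of [r Q Q] is a sum of moments of squares; if it is zero, every entry in that
   row of [Q T] is zero. *)
have r_def Q : (forall i, r Q Q i i = 0) -> Q = 0.
  move=> Q0; suff QT : Q *m Tpol N a = 0.
    by rewrite -[Q]mulmx1 -(Tpol_inv a) mulmxA QT mul0mx.
  apply/matrixP => i k; rewrite [RHS]mxE.
  have hk := hw k (ltn_ord k); apply: (moment_sqr_eq0 mI hk I0).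
  have := Q0 i; rewrite /r => /eqP; rewrite psumr_eq0; last first.
    by move=> l _; exact: (moment_sqr_ge0 (hw l (ltn_ord l))).
  by move=> /allP /(_ k (mem_index_enum k)) /eqP.
have [[dPn mPn] oPn] := hP n.
(* As [P n] is monic, the eigenvalue can only be the coefficient of degree [n] of [P_n . D]. *)
pose M := mcoef (act (P n) D) n; exists M.
apply/eqP; rewrite -subr_eq0; apply/eqP; set S := _ - _.
have dA : deg_lt (act (P n) D) n.+1 by exact: act_deg_lt.
have dS : deg_lt S n.
  move=> i j; apply/leq_sizeP => l; rewrite leq_eqVlt => /orP[/eqP <-|nl].
    have -> : (S i j)`_n = mcoef (act (P n) D) n i j - (M *m mcoef (P n) n) i j.
      rewrite /S !mxE coefB; congr (_ - _).
      rewrite coef_sum; apply: eq_bigr => l' _.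
      by rewrite !mxE coefCM.
    by rewrite mPn mulmx1 subrr.
  rewrite /S mxE [X in _ + X]mxE [X in _ - X]mxE coefB coef_sum (nth_default _ (leq_trans (dA i j) nl)) big1 ?subr0// => k _.
  by rewrite mxE coefCM (nth_default _ (leq_trans (dPn k j) nl)) mulr0.
(* Expanding only the first argument leaves pairings of [P n] with [S . D] and with [S], both of
   degree less than [n], hence zero. *)
apply: r_def => i; rewrite {1}/S r_lin r_sym.
have oR Q : deg_lt Q n -> forall i j, r (P n) Q i j = 0.
  by move=> dQ i' j'; apply: EFin_inj; rewrite -ipE oPn.
rewrite oR; last exact: act_deg_lt.
by rewrite big1 ?subrr// => l _; rewrite oR// mulr0.
Qed.

End orthogonality.

(** * Reduction to identities between constant matrices *)

Section affine.
Variables (R : realType) (N : nat) (a : nat -> R).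
Notation A := (Amx N a).
Notation K := (Kmx R N).
Implicit Types (G U V C : 'M[R]_N).

(** The parity flips because [diagN] evaluates its function at the 1-based index. *)
Lemma Kmx_diagN : K = diagN N (fun j => (~~ odd j)%:R).
Proof. by apply/matrixP => i j; rewrite !mxE /= negbK -natrM mulnb. Qed.

Lemma Kmx_Amx : K *m A = 0.
Proof.
rewrite Kmx_diagN diagN_row; apply/matrixP => i j; rewrite mul_diag_mx [RHS]mxE [LHS]mxE [X in X * _]mxE.
rewrite /= negbK; case: (boolP (odd i)) => oi; last by rewrite mul0r.
by rewrite Amx_eq0 ?oi// mulr0.
Qed.

Lemma Amx_Kmx : A *m K = A.
Proof.
rewrite Kmx_diagN diagN_row; apply/matrixP => i j; rewrite mul_mx_diag [LHS]mxE [X in _ * X]mxE.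
rewrite /= negbK; case: (boolP (odd j)) => oj; first by rewrite mulr1.
by rewrite mulr0 [RHS]Amx_eq0// oj orbT.
Qed.

(** With [sigma] quadratic and [tau] affine, the intertwining equations are compared power by power
    of [x]: degrees 0, 1 and 2 of the first order equation give the conditions on [g0] and [g1]. The
    condition on [C] is degree 1 of the order zero equation, where [A U A = 0]. *)
Lemma in_DW_affine (I : set R) w (s0 s1 s2 : R) (u v c : nat -> R) (g0 g1 : 'M[R]_N)
    (D : diffop R N) :
  let sigma : {poly R} := s0%:P + s1%:P * 'X + s2%:P * 'X ^+ 2 in
  let U := diagN N u in let V := diagN N v in let C := diagN N c in
  measurable I -> lebesgue_measure I != 0%E ->
  (forall k, (k < N)%N ->
     pearson_weight I (w k.+1) sigma ((u k.+1)%:P - (v k.+1)%:P * 'X)) ->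
  F2 D = sigma *: 1%:M ->
  F1 D = cmx g0 + 'X *: cmx g1 ->
  F0 D = cmx (A *m U + C) ->
  g0 = (2 * s0) *: A + U ->
  g1 + g0 *m A = (2 * s1) *: A + A *m U - V ->
  g1 *m A = (2 * s2) *: A - A *m V ->
  C *m A = A *m C - A *m V ->
  in_DW I (Wmx N a w) D.
Proof.
move=> sigma U V C mI I0 hw e2 e1 e0 h0 h1 h2 hC.
have UE : diagp N (fun j => (u j)%:P - (v j)%:P * 'X) = cmx U - 'X *: cmx V.
  apply/matrixP => r s; rewrite !mxE; case: eqP => [->|_].
    by rewrite !mul1r mulr1n mulrC.
  by rewrite !mul0r mulr0n mulr0 subr0.
have cM (X Y : 'M[R]_N) : cmx X *m cmx Y = cmx (X *m Y) by rewrite /cmx map_mxM.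
have AUA : A *m U *m A = 0 by exact: Amx_diag_Amx.
apply: (@in_DW_intertwines _ _ _ _ _ sigma (fun j => (u j)%:P - (v j)%:P * 'X) c) => //.
- split => //.
  + rewrite e1 UE /Tpol !mulmxDl !mulmxDr !mul1mx !mulmx1 -!scalemxAl -!scalemxAr !mulmxN.
    rewrite -!scalemxAr !cM h2.
    have -> : g1 = (2 * s1) *: A + A *m U - V - g0 *m A by rewrite -h1 addrK.
    move: (g0 *m A) (A *m U) (A *m V) => X Y Z; rewrite h0.
    apply/matrixP => i j; rewrite /sigma; move: (Amx N a) => A'.
    rewrite !mxE !(polyCD, polyCN, polyCB, polyCM) -(polyC_natr R 2).
    ring.
  + rewrite e0 UE /Tpol mulmxDr mulmx1 !mulmxDl !mul1mx mulmxBr.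
    rewrite -!scalemxAr -!scalemxAl !cM mulmxDl AUA add0r hC.
    move: (A *m U) (A *m V) (A *m C) => X Y Z.
    apply/matrixP => i j.
    rewrite !mxE !(polyCD, polyCN, polyCB, polyCM).
    ring.
- move=> i j; rewrite e2 !mxE; case: eqP => _; last by rewrite mulr0n mulr0 size_poly0.
  rewrite mulr1n mulr1; apply/leq_sizeP => l; rewrite /sigma !coefD !coefCM coefC coefX coefXn.
  by case: l => [|[|[|l]]]//= _; rewrite !mulr0 !addr0.
- move=> i j; rewrite e1 !mxE; apply/leq_sizeP => l; rewrite coefD coefXM !coefC.
  by case: l => [|[|l]]//= _; rewrite addr0.
- by move=> i j; rewrite e0 mxE size_polyC leq_b1.
Qed.

End affine.

(** * Verification for the three weights *)

Theorem theorem4p2 (R : realType) (N : nat) (hN : (2 <= N)%N)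
  (a : nat -> R) (ha : forall j, (0 < j < N)%N -> a j != 0) :
  (* Hermite *)
  (forall b : nat -> R,
     (forall i j, (1 <= i <= N)%N -> (1 <= j <= N)%N -> i <> j -> b i != b j) ->
     in_DW [set: R] (@W_H R N a b) (@D_H R N a b))
  /\
  (* Laguerre *)
  (forall al : nat -> R,
     (forall i, (1 <= i <= N)%N -> -1 < al i) ->
     (forall i j, (1 <= i <= N)%N -> (1 <= j <= N)%N -> i <> j ->
        forall z : int, al i - al j != z%:~R) ->
     in_DW `]0, +oo[ (@W_L R N a al) (@D_L R N a al))
  /\
  (* Jacobi *)
  (forall al be : nat -> R,
     (forall i, (1 <= i <= N)%N -> -1 < al i /\ -1 < be i) ->
     (forall i j, (1 <= i <= N)%N -> (1 <= j <= N)%N -> i <> j ->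
        (forall z : int, al i - al j != z%:~R) \/
        (forall z : int, be i - be j != z%:~R)) ->
     (forall j, (1 <= j <= N)%N ->
        al 1%N + be 1%N = al j + be j + 1 + (-1) ^+ j) ->
     in_DW `]-1, 1[ (@W_J R N a al be) (@D_J R N a al be)).
Proof.
have AE (d : nat -> R) := Amx_diag_Amx N a d.
have AA := Amx_sqr0 N a.
have KA := Kmx_Amx N a.
have AK := Amx_Kmx N a.
have diag_const (v : R) : diagN N (fun=> v) = v%:M.
  by apply/matrixP => i j; rewrite !mxE; case: eqP => _; rewrite ?mul1r ?mul0r.
have diagZ (v : R) : diagN N (fun j => v * (~~ odd j)%:R) = v *: Kmx R N.
  by rewrite Kmx_diagN; apply/matrixP => i j; rewrite !mxE mulrCA.
split; last split.
- move=> b _.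
  (* Here [sigma = 1], [tau = 2 b_j - 2 x] and [C = 2 K]; with [K A = 0] and [A K = A] this gives
     [C A = 0] and [A C = A V = 2 A]. *)
  apply: (@in_DW_affine _ _ a _ _ 1 0 0 (fun j => 2 * b j) (fun=> 2)
    (fun j => 2 * (~~ odd j)%:R) (2 *: Amx N a + B_H N b) (comm (Amx N a) (B_H N b) - 2%:M)).
  + exact: measurableT.
  + exact: exhausts_measure_neq0 (exhaustsT R).
  + move=> k _; rewrite !mul0r !addr0; exact: pearson_weight_herm.
  + by rewrite /D_H /= cmx1 !mul0r !addr0 scale1r.
  + by [].
  + by rewrite /D_H /= diagZ.
  + by rewrite mulr1.
  + rewrite diag_const /comm mulmxDl -scalemxAl AA scaler0 add0r mulr0 scale0r add0r.
    by rewrite addrAC subrK.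
  + rewrite diag_const /comm !mulmxBl AE -mulmxA AA mulmx0 subrr.
    by rewrite mulr0 scale0r mul_scalar_mx mul_mx_scalar.
  + by rewrite diag_const diagZ -scalemxAl KA scaler0 -scalemxAr AK mul_mx_scalar subrr.
- move=> al hal _.
  (* Here [sigma = x], [tau = al_j + 1 - x] and [C = K]; the factor 1 in [c] lets [diagZ] apply. *)
  apply: (@in_DW_affine _ _ a _ _ 0 1 0 (fun j => al j + 1) (fun=> 1)
    (fun j => 1 * (~~ odd j)%:R) (B_L N al)
    (- 1%:M + 2 *: Amx N a + comm (Amx N a) (B_L N al))).
  + exact: measurable_itv.
  + exact: exhausts_measure_neq0 (exhausts0y R).
  + move=> k kN; rewrite polyC0 polyC1 mul0r !mul1r addr0 add0r.
    by apply: pearson_weight_lag; apply: hal.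
  + by rewrite /D_L /= cmx1 polyC0 polyC1 mul0r mul1r addr0 add0r.
  + by [].
  + by rewrite /D_L /= diagZ scale1r.
  + by rewrite mulr0 scale0r add0r.
  + rewrite diag_const /comm mulr1 -addrA subrK.
    by rewrite -addrA addrC.
  + rewrite diag_const /comm !mulmxDl !mulNmx AE -scalemxAl AA -mulmxA AA mulmx0.
    by rewrite mulr0 scale0r scaler0 subrr !addr0 mul1mx mulmx1 sub0r.
  + by rewrite diag_const diagZ scale1r KA AK mulmx1 subrr.
- move=> al be hab _ hs; set s := al 1%N + be 1%N.
  (* The parity condition makes [al_j + be_j] equal to [s] for odd [j] and [s - 2] for even [j].
     Consequently [A V = s A], which is [A C] for [C = s K]. *)
  have VE : diagN N (fun j => al j + be j + 2) = (s + 2)%:M - 2 *: Kmx R N.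
    apply/matrixP => i j; rewrite !mxE; case: eqP => [->|_]; last by rewrite /= !mul0r mulr0 subr0.
    rewrite mul1r mulr1n /s (hs j.+1) //= -signr_odd /=.
    by case: (odd j) => /=; rewrite ?expr0 ?expr1 /=; ring.
  apply: (@in_DW_affine _ _ a _ _ 1 0 (-1) (fun j => be j - al j) (fun j => al j + be j + 2)
    (fun j => s * (~~ odd j)%:R) (2 *: Amx N a + B_J N al be)
    (comm (Amx N a) (B_J N al be) + 2 *: Kmx R N - (s + 2)%:M)).
  + exact: measurable_itv.
  + exact: exhausts_measure_neq0 (exhaustsN11 R).
  + move=> k kN; rewrite polyC0 polyCN polyC1 mul0r addr0 mulN1r.
    by have [? ?] := hab k.+1 kN; apply: pearson_weight_jac.
  + by rewrite /D_J /= cmx1 polyC0 polyCN polyC1 mul0r addr0 mulN1r.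
  + by [].
  + by rewrite /D_J /= diagZ.
  + by rewrite mulr1.
  + rewrite VE /comm mulmxDl -scalemxAl AA scaler0 add0r mulr0 scale0r add0r.
    move: (Amx N a *m _) (B_J N al be *m _) (2 *: Kmx R N) => X Y Z.
    by rewrite opprB -!addrA; congr (_ + _); rewrite addrC -!addrA subrr addr0.
  + rewrite VE /comm !mulmxDl !mulNmx AE -scalemxAl KA -mulmxA AA mulmx0 mulmxBr -scalemxAr AK.
    rewrite scaler0 subrr !add0r mul_scalar_mx mul_mx_scalar opprB.
    by rewrite mulrN1 scaleNr addKr.
  + rewrite VE diagZ -scalemxAl KA scaler0 -scalemxAr mulmxBr -scalemxAr AK mul_mx_scalar.
    by rewrite (scalerDl _ s) addrK subrr.
Qed.
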